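(* If $G$ is a connected graph, then $\gamma_{\rm cg}(G) \le \gamma_{\rm tcg}(G) \le \gamma_{\rm cg}(G) + 2$.
   Context: All graphs are finite and simple. For a vertex $v$ of $G$, $N(v)$ is its open neighborhood and $N[v]=N(v)\cup\{v\}$ its closed neighborhood. The connected domination game on a connected graph $G$ is played by two players, Dominator and Staller, who alternately select previously unselected vertices of $G$, Dominator moving first. Each selected vertex must dominate (i.e. have in its closed neighborhood) at least one vertex not dominated by the previously selected vertices, and at every stage the set of selected vertices must induce a connected subgraph of $G$. The game ends when no legal move exists; Dominator aims to minimize and Staller to maximize the number of selected vertices. With both playing optimally, this number is the connected game domination number $\gamma_{\rm cg}(G)$. The total connected domination game is defined identically except that each selected vertex must totally dominate (i.e. have in its open neighborhood) at least one vertex not totally dominated by previously selected vertices (still with the connectivity requirement at every stage and Dominator moving first); the optimal number of selected vertices is $\gamma_{\rm tcg}(G)$.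
   Formalization: The graph is assumed to have at least two vertices: for the one-vertex graph no total domination move is legal, so its connected game domination number is 1 while its total version is 0, and the first inequality fails. *)

(* Defs.v *)
From mathcomp Require Import all_boot.

Set Implicit Arguments.
Unset Strict Implicit.
Unset Printing Implicit Defensive.

(* A finite simple graph is a symmetric irreflexive relation e on a finType V;
   both properties are hypotheses of the theorems, not built into e. *)

Definition open_nbhd (V : finType) (e : rel V) (v : V) : {set V} :=
  [set u | e v u].

Definition closed_nbhd (V : finType) (e : rel V) (v : V) : {set V} :=
  v |: open_nbhd e v.

Definition connected_graph (V : finType) (e : rel V) : Prop :=
  forall x y : V, connect e x y.

Definition induces_connected (V : finType) (e : rel V) (S : {set V}) : bool :=
  [forall x in S, forall y in S,
     connect [rel u v | [&& e u v, u \in S & v \in S]] x y].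

(* Both games share one move rule, parametrized by the set N v of vertices that
   v dominates: N is closed_nbhd for domination, open_nbhd for total
   domination. S is the set of vertices selected so far. *)
Definition legal_moves (V : finType) (e : rel V) (N : V -> {set V})
    (S : {set V}) : {set V} :=
  [set v | [&& v \notin S, induces_connected e (v |: S)
             & ~~ (N v \subset \bigcup_(u in S) N u)]].

Variant player := Dominator | Staller.

Definition opponent (p : player) : player :=
  if p is Dominator then Staller else Dominator.

(* Number of vertices still to be selected from position S, with p to move and
   optimal play, over at most k moves. The legal move v0 only serves as the
   neutral element of a minimum over a set that contains it. *)
Fixpoint moves_within (V : finType) (e : rel V) (N : V -> {set V})
    (k : nat) (p : player) (S : {set V}) : nat :=
  if k is k'.+1 then
    if [pick v0 in legal_moves e N S] is Some v0 then
      let after v := moves_within e N k' (opponent p) (v |: S) in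
      (if p is Dominator then
         \big[minn/after v0]_(v in legal_moves e N S) after v
       else \max_(v in legal_moves e N S) after v).+1
    else 0
  else 0.

(* A move selects a new vertex, so the number of unselected vertices bounds the
   length of play; game_movesP below shows that the bound is harmless. *)
Definition game_moves (V : finType) (e : rel V) (N : V -> {set V})
    (p : player) (S : {set V}) : nat :=
  moves_within e N #|~: S| p S.

Definition gamma_cg (V : finType) (e : rel V) : nat :=
  game_moves e (closed_nbhd e) Dominator set0.

Definition gamma_tcg (V : finType) (e : rel V) : nat :=
  game_moves e (open_nbhd e) Dominator set0.

Lemma legal_moves_card (V : finType) (e : rel V) (N : V -> {set V})
    (S : {set V}) (v : V) :
  v \in legal_moves e N S -> #|~: S| = #|~: (v |: S)|.+1.
Proof.
rewrite inE => /and3P[vS _ _].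
by rewrite (cardsD1 v) inE vS setCU setIC -setDE.
Qed.

Lemma moves_within_stable (V : finType) (e : rel V) (N : V -> {set V})
    (k : nat) (p : player) (S : {set V}) :
  #|~: S| <= k -> moves_within e N k p S = game_moves e N p S.
Proof.
rewrite /game_moves; move eqm: #|~: S| => m lemk.
elim: k m p S eqm lemk => [|k IHk] [|m] p S eqm // lemk /=;
  case: pickP => // v0 lv0.
  by move: (legal_moves_card lv0); rewrite eqm.
have afterE v : v \in legal_moves e N S ->
    moves_within e N k (opponent p) (v |: S)
    = moves_within e N m (opponent p) (v |: S).
  by move=> /legal_moves_card; rewrite eqm => -[eqv]; apply: IHk.
congr _.+1; case: p afterE => afterE; last exact: eq_bigr.
by rewrite (afterE _ lv0); apply: eq_bigr.
Qed.

Lemma game_moves_end (V : finType) (e : rel V) (N : V -> {set V})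
    (p : player) (S : {set V}) :
  legal_moves e N S = set0 -> game_moves e N p S = 0.
Proof.
rewrite /game_moves => l0; case: #|_| => //= k.
by case: pickP => // v; rewrite l0 inE.
Qed.

Lemma bigminn_le (V : finType) (A : {set V}) (F : V -> nat) (x0 : nat) (v : V) :
  v \in A -> \big[minn/x0]_(u in A) F u <= F v.
Proof.
move=> Av; have := mem_index_enum v; elim: (index_enum V) => // a s IHs.
rewrite inE big_cons => /predU1P[<-|/IHs le_s]; first by rewrite Av geq_minl.
by case: ifP => // _; apply: leq_trans (geq_minr _ _) le_s.
Qed.

(* The value of a position satisfies the minimax equations of the game. *)
Lemma game_movesP (V : finType) (e : rel V) (N : V -> {set V})
    (p : player) (S : {set V}) :
  legal_moves e N S != set0 ->
  let after v := game_moves e N (opponent p) (v |: S) in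
  (exists2 v, v \in legal_moves e N S & game_moves e N p S = (after v).+1) /\
  (forall v, v \in legal_moves e N S ->
     if p is Dominator then game_moves e N p S <= (after v).+1
     else (after v).+1 <= game_moves e N p S).
Proof.
case/set0Pn=> v1 lv1 /=.
have [k eqk] : {k | #|~: S| = k.+1}.
  by exists #|~: (v1 |: S)|; apply: legal_moves_card lv1.
rewrite {1 3 6}/game_moves eqk /=.
case: pickP => [v0 lv0|/(_ v1)]; last by rewrite lv1.
have afterE v : v \in legal_moves e N S ->
    moves_within e N k (opponent p) (v |: S)
    = game_moves e N (opponent p) (v |: S).
  move=> /legal_moves_card; rewrite eqk => -[eqv].
  by apply: moves_within_stable; rewrite eqv.
case: p afterE => afterE.
- rewrite (afterE _ lv0) (eq_bigr _ afterE); split=> [|v lv].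
    elim/big_ind: _ => [|x y [v lv [->]] [w lw [->]]|v lv].
    + by exists v0.
    + by rewrite /minn; case: ifP => _; [exists v | exists w].
    + by exists v.
  by rewrite ltnS; apply: bigminn_le.
- rewrite (eq_bigr _ afterE); split=> [|v lv]; last first.
    by rewrite ltnS (bigD1 v) // leq_maxl.
  have [|v lv ->] := eq_bigmax_cond
    (fun v => game_moves e N (opponent Staller) (v |: S))
    (A := mem (legal_moves e N S)).
    by apply/card_gt0P; exists v0.
  by exists v.
Qed.

(* Main.v *)
(* Once two vertices have been selected, the two games have the same legal
   moves: a connected set with at least two vertices totally dominates exactly
   what it dominates. They differ only in that, after the first move v, the
   total game also allows a neighbor u of v with N[u] contained in N[v]. Such a
   move acts as a pass of Staller, and it costs Dominator at most one extra
   move by the continuation principle game_closed_mono: enlarging the dominated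
   set by the neighborhood of an already dominated vertex, with the same player
   to move, never increases the number of remaining moves. *)
Require Import Defs.
From mathcomp Require Import all_boot.

Set Implicit Arguments.
Unset Strict Implicit.
Unset Printing Implicit Defensive.

(** * Minimax values and optimal moves *)

Lemma game_moves_attained (V : finType) (e : rel V) (N : V -> {set V})
    (p : player) (S : {set V}) :
  game_moves e N p S = 0 \/
  exists2 v, v \in legal_moves e N S
    & game_moves e N p S = (game_moves e N (opponent p) (v |: S)).+1.
Proof.
have [l0|ln0] := eqVneq (legal_moves e N S) set0.
  by left; apply: game_moves_end.
by right; have [] := game_movesP p ln0.
Qed.

Lemma game_moves_Staller (V : finType) (e : rel V) (N : V -> {set V})
    (S : {set V}) (v : V) :
  v \in legal_moves e N S ->
  game_moves e N Dominator (v |: S) < game_moves e N Staller S.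
Proof.
move=> lv; have ln0 : legal_moves e N S != set0 by apply/set0Pn; exists v.
by have [_ /(_ v lv)] := game_movesP Staller ln0.
Qed.

Lemma game_moves_Dominator (V : finType) (e : rel V) (N : V -> {set V})
    (S : {set V}) (v : V) :
  v \in legal_moves e N S ->
  game_moves e N Dominator S <= (game_moves e N Staller (v |: S)).+1.
Proof.
move=> lv; have ln0 : legal_moves e N S != set0 by apply/set0Pn; exists v.
by have [_ /(_ v lv)] := game_movesP Dominator ln0.
Qed.

(** With an invariant of play for [P], the two move rules have to agree only where it holds, not on
    the opening positions, where they may differ. *)
Lemma eq_game_moves (V : finType) (e : rel V) (N1 N2 : V -> {set V})
    (P : {set V} -> Prop) :
  (forall S, P S -> legal_moves e N1 S = legal_moves e N2 S) ->
  (forall S v, P S -> v \in legal_moves e N1 S -> P (v |: S)) ->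
  forall p S, P S -> game_moves e N1 p S = game_moves e N2 p S.
Proof.
move=> eqN stepP p S; rewrite /game_moves; move: #|~: S| => k.
elim: k p S => // k IHk p S PS /=; rewrite -(eqN S PS).
case: pickP => // v0 lv0; congr _.+1.
have eqv v : v \in legal_moves e N1 S ->
    moves_within e N1 k (opponent p) (v |: S)
    = moves_within e N2 k (opponent p) (v |: S).
  by move=> lv; apply/IHk/stepP.
case: p eqv => eqv; last exact: eq_bigr.
by rewrite (eqv _ lv0); apply: eq_bigr.
Qed.

(** * Connected induced subgraphs *)

Lemma induces_connectedP (V : finType) (e : rel V) (S : {set V}) :
  reflect {in S &, forall x y,
             connect [rel u v | [&& e u v, u \in S & v \in S]] x y}
          (induces_connected e S).
Proof.
apply: (iffP forall_inP) => [conS x y xS yS|conS x xS].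
  by have /forall_inP/(_ y yS) := conS x xS.
by apply/forall_inP => y yS; apply: conS.
Qed.

Lemma induces_connected1 (V : finType) (e : rel V) (v : V) :
  induces_connected e [set v].
Proof. by apply/induces_connectedP => x y /set1P-> /set1P->; apply: connect0. Qed.

Lemma induces_connected_nbr (V : finType) (e : rel V) (S : {set V}) (x y : V) :
  induces_connected e S -> x \in S -> y \in S -> x != y ->
  exists2 z, z \in S & e x z.
Proof.
move=> /induces_connectedP conS xS yS nxy.
have /connectP[[|z p] /= ] := conS x y xS yS; first by move=> _ eyx; rewrite eyx eqxx in nxy.
by case/andP=> /and3P[exz _ zS] _ _; exists z.
Qed.

Lemma induces_connectedU1 (V : finType) (e : rel V) (S : {set V}) (u v : V) :
  symmetric e -> induces_connected e S -> u \in S -> e v u ->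
  induces_connected e (v |: S).
Proof.
move=> e_sym /induces_connectedP conS uS evu.
set r := [rel x y | [&& e x y, x \in v |: S & y \in v |: S]].
have r_sym : connect_sym r.
  by apply: sym_connect_sym => x y /=; rewrite e_sym [(x \in _) && _]andbC.
have to_u x : x \in v |: S -> connect r x u.
  case/setU1P=> [->|xS]; first by apply: connect1; rewrite /= evu !inE eqxx uS orbT.
  apply: connect_sub (conS x u xS uS) => a b /and3P[eab aS bS].
  by apply: connect1; rewrite /= eab !inE aS bS !orbT.
apply/induces_connectedP => x y xS yS.
by apply: connect_trans (to_u x xS) _; rewrite r_sym; apply: to_u.
Qed.

(** * The domination game: dominated sets, legal moves, continuation *)

Definition dominated (V : finType) (e : rel V) (S : {set V}) : {set V} :=
  \bigcup_(u in S) closed_nbhd e u.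

(** Nonemptiness excludes the opening, where connectivity does not restrict the choice of a
    vertex. *)
Definition position (V : finType) (e : rel V) (S : {set V}) : bool :=
  (S != set0) && induces_connected e S.

Lemma dominatedU1 (V : finType) (e : rel V) (S : {set V}) (v : V) :
  dominated e (v |: S) = closed_nbhd e v :|: dominated e S.
Proof. by rewrite /dominated bigcup_setU big_set1. Qed.

Lemma sub_dominated (V : finType) (e : rel V) (S : {set V}) :
  S \subset dominated e S.
Proof. by apply/subsetP => v vS; apply/bigcupP; exists v => //; rewrite !inE eqxx. Qed.

Lemma closed_nbhd_dominated (V : finType) (e : rel V) (S : {set V}) (v : V) :
  v \in S -> closed_nbhd e v \subset dominated e S.
Proof. by move=> vS; apply: (bigcup_sup v). Qed.

Lemma position_legal (V : finType) (e : rel V) (N : V -> {set V})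
    (S : {set V}) (v : V) :
  v \in legal_moves e N S -> position e (v |: S).
Proof.
rewrite inE => /and3P[_ conS _]; apply/andP; split=> //.
by apply/set0Pn; exists v; rewrite setU11.
Qed.

Lemma legal_nbr (V : finType) (e : rel V) (S : {set V}) (v : V) :
  irreflexive e -> S != set0 -> v \notin S -> induces_connected e (v |: S) ->
  exists2 u, u \in S & e v u.
Proof.
move=> e_irr /set0Pn[s sS] vS conS.
have nvs : v != s by apply: contraNneq vS => ->.
have [||z /setU1P[->|zS] evz] := induces_connected_nbr conS _ _ nvs.
- exact: setU11.
- exact: setU1r.
- by rewrite e_irr in evz.
- by exists z.
Qed.

(** A vertex outside [S] keeps the selection connected iff it has a neighbor in [S], and a vertex of
    [S] dominates nothing new. Legality thus depends on [dominated e S] alone, so positions with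
    different selected vertices can be compared. *)
Lemma legal_closedE (V : finType) (e : rel V) (S : {set V}) (v : V) :
  symmetric e -> irreflexive e -> position e S ->
  (v \in legal_moves e (closed_nbhd e) S) =
  (v \in dominated e S) && ~~ (closed_nbhd e v \subset dominated e S).
Proof.
move=> e_sym e_irr /andP[Sn0 conS]; rewrite inE -/(dominated e S).
apply/and3P/andP => [[vS conU nsub]|[/bigcupP[u uS vu] nsub]].
  split=> //; have [u uS evu] := legal_nbr e_irr Sn0 vS conU.
  by apply/bigcupP; exists u; rewrite // !inE e_sym evu orbT.
have vS : v \notin S by apply: contra nsub; apply: closed_nbhd_dominated.
split=> //; move: vu; rewrite !inE => /orP[/eqP evu|euv].
  by rewrite evu uS in vS.
by apply: (induces_connectedU1 e_sym conS uS); rewrite e_sym.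
Qed.

(** Without a legal move the dominated set would be closed under adjacency, hence equal to [V] by
    connectedness. *)
Lemma legal_closed_exists (V : finType) (e : rel V) (S : {set V}) :
  symmetric e -> irreflexive e -> connected_graph e -> position e S ->
  dominated e S != setT ->
  exists v, v \in legal_moves e (closed_nbhd e) S.
Proof.
move=> e_sym e_irr e_conn posS nT; apply/existsP; apply: contraR nT => /existsPn noL.
have [/set0Pn[s sS] _] := andP posS.
have clD : closed e (mem (dominated e S)).
  apply: intro_closed => [|x y exy xD]; first exact: sym_connect_sym.
  have := noL x; rewrite legal_closedE // [x \in _]xD negbK => /subsetP; apply.
  by rewrite !inE exy orbT.
apply/eqP/setP => y; rewrite inE.
have <- := closed_connect clD (e_conn s y).
exact: (subsetP (sub_dominated e S)).
Qed.

(** Imagination strategy: moves are copied between [S] and [T] so that the dominated sets again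
    differ by one closed neighborhood, possibly of another [w]. The induction is on the number of
    vertices undominated in [S]. *)
Lemma game_closed_mono (V : finType) (e : rel V) (p : player)
    (S T : {set V}) (w : V) :
  symmetric e -> irreflexive e -> connected_graph e ->
  position e S -> position e T -> w \in dominated e S ->
  dominated e T = closed_nbhd e w :|: dominated e S ->
  game_moves e (closed_nbhd e) p T <= game_moves e (closed_nbhd e) p S.
Proof.
move=> e_sym e_irr e_conn.
have [n] := ubnP #|~: dominated e S|.
elim: n => // n IHn in p S T w *; rewrite ltnS => leSn posS posT wS domT.
have legalE R v : position e R -> v \in legal_moves e (closed_nbhd e) R =
    (v \in dominated e R) && ~~ (closed_nbhd e v \subset dominated e R).
  exact: legal_closedE.
have subST : dominated e S \subset dominated e T by rewrite domT subsetUr.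
have shrink R v : dominated e S \subset dominated e R ->
    ~~ (closed_nbhd e v \subset dominated e S) ->
    closed_nbhd e v \subset dominated e R -> #|~: dominated e R| < n.
  move=> subSR nS vR; apply: leq_trans leSn; apply: proper_card.
  rewrite properC; apply/properP; split=> //.
  by have /subsetPn[x xv xS] := nS; exists x => //; apply: (subsetP vR).
have shrinkU v : ~~ (closed_nbhd e v \subset dominated e S) ->
    #|~: dominated e (v |: S)| < n.
  by move=> nS; apply: (shrink _ v) => //; rewrite dominatedU1 (subsetUl, subsetUr).
case: p.
- have [/eqP domTT|nT] := boolP (dominated e T == setT).
    rewrite game_moves_end //; apply/setP => v.
    by rewrite legalE // domTT subsetT andbF inE.
  have [z lz] := legal_closed_exists e_sym e_irr e_conn posT nT.
  have nS : dominated e S != setT.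
    by apply: contraNneq nT => eST; rewrite -subTset -eST.
  have [y0 ly0] := legal_closed_exists e_sym e_irr e_conn posS nS.
  have [[y ly ->] _] := game_movesP Dominator
    (introT (set0Pn _) (ex_intro _ y0 ly0)).
  move: (ly); rewrite legalE // => /andP[yS nyS].
  have [yT|nyT] := boolP (closed_nbhd e y \subset dominated e T).
    (* The imagined reply y is useless in T, so any legal z will do there. *)
    apply: leq_trans (game_moves_Dominator lz) _; rewrite ltnS.
    have zT : z \in dominated e T by move: lz; rewrite legalE // => /andP[].
    (* The middle term is [T] with Staller to move: [z |: T] extends [T] by the neighborhood of [z],
       and [T] extends [y |: S] by that of [w]. The first comparison has a smaller measure because
       [T] dominates all that [y] adds to [S]. *)
    apply: (@leq_trans (game_moves e (closed_nbhd e) Staller T)).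
      apply: (IHn _ _ _ z) => //; last exact: dominatedU1.
        exact: (shrink _ y).
      exact: position_legal lz.
    apply: (IHn _ _ _ w) => //; first exact: shrinkU.
    - exact: position_legal ly.
    - by rewrite dominatedU1 inE wS orbT.
    - by rewrite dominatedU1 setUCA -domT; apply/esym/setUidPr.
  have lyT : y \in legal_moves e (closed_nbhd e) T.
    by rewrite legalE // (subsetP subST) // nyT.
  apply: leq_trans (game_moves_Dominator lyT) _; rewrite ltnS.
  apply: (IHn _ _ _ w) => //; first exact: shrinkU.
  + exact: position_legal ly.
  + exact: position_legal lyT.
  + by rewrite dominatedU1 inE wS orbT.
  + by rewrite !dominatedU1 domT setUCA.
(* Here copying goes the other way: the optimal move [x] of Staller in [T] is imitated in [S]. *)
- have [->//|[x lx ->]] := game_moves_attained e (closed_nbhd e) Staller T.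
  move: (lx); rewrite legalE // => /andP[xT nxT].
  have [xS|nxS] := boolP (x \in dominated e S).
    have nxS : ~~ (closed_nbhd e x \subset dominated e S).
      by apply: contra nxT => /subset_trans; apply.
    have lxS : x \in legal_moves e (closed_nbhd e) S by rewrite legalE // xS.
    apply: leq_trans (game_moves_Staller lxS); rewrite ltnS.
    apply: (IHn _ _ _ w) => //; first exact: shrinkU.
    + exact: position_legal lxS.
    + exact: position_legal lx.
    + by rewrite dominatedU1 inE wS orbT.
    + by rewrite !dominatedU1 domT setUCA.
  (* If x is not yet playable in S, then Staller plays w there instead. *)
  have xw : x \in closed_nbhd e w.
    by move: xT; rewrite domT inE (negPf nxS) orbF.
  have nwS : ~~ (closed_nbhd e w \subset dominated e S).
    by apply/subsetPn; exists x.
  have lw : w \in legal_moves e (closed_nbhd e) S by rewrite legalE // wS.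
  apply: leq_trans (game_moves_Staller lw); rewrite ltnS.
  (* The roles swap: [x |: T] dominates what [w |: S] does, plus the neighborhood of [x]. *)
  apply: (IHn _ _ _ x) => //; first exact: shrinkU.
  + exact: position_legal lw.
  + exact: position_legal lx.
  + by rewrite dominatedU1 inE xw.
  + by rewrite !dominatedU1 domT.
Qed.

(** After an optimal move of Dominator, Staller faces an enlarged dominated set, which by
    continuation is no better for Staller than [S]. *)
Lemma game_closed_pass (V : finType) (e : rel V) (S : {set V}) :
  symmetric e -> irreflexive e -> connected_graph e -> position e S ->
  game_moves e (closed_nbhd e) Dominator S
    <= (game_moves e (closed_nbhd e) Staller S).+1.
Proof.
move=> e_sym e_irr e_conn posS.
have [->//|[v lv ->]] := game_moves_attained e (closed_nbhd e) Dominator S.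
rewrite ltnS; apply: (game_closed_mono _ e_sym e_irr e_conn posS _ (w := v)).
- exact: position_legal lv.
- by move: lv; rewrite legal_closedE // => /andP[].
- exact: dominatedU1.
Qed.

(** * Agreement of the two games from the second move on *)

Lemma open_bigcup (V : finType) (e : rel V) (S : {set V}) :
  symmetric e -> induces_connected e S -> 1 < #|S| ->
  \bigcup_(u in S) open_nbhd e u = dominated e S.
Proof.
move=> e_sym conS /card_gt1P[x [y [xS yS nxy]]].
(* As [u] differs from [x] or from [y], it has a selected neighbor, which totally dominates it. *)
have nbr u : u \in S -> exists2 z, z \in S & e u z.
  move=> uS; have [eux|nux] := eqVneq u x.
    by apply: (induces_connected_nbr conS uS yS); rewrite eux.
  exact: (induces_connected_nbr conS uS xS).
apply/eqP; rewrite eqEsubset; apply/andP; split; apply/bigcupsP => u uS.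
  by apply: subset_trans (closed_nbhd_dominated _ uS); apply: subsetUr.
have [z zS euz] := nbr u uS.
rewrite subUset sub1set (bigcup_sup u) // andbT.
by apply/bigcupP; exists z; rewrite // inE e_sym.
Qed.

Lemma legal_open_closed (V : finType) (e : rel V) (S : {set V}) :
  symmetric e -> irreflexive e -> induces_connected e S -> 1 < #|S| ->
  legal_moves e (open_nbhd e) S = legal_moves e (closed_nbhd e) S.
Proof.
move=> e_sym e_irr conS gt1; apply/setP => v; rewrite !inE open_bigcup //.
apply: andb_id2l => vS; apply: andb_id2l => conU.
have Sn0 : S != set0 by rewrite -card_gt0 ltnW.
have [u uS evu] := legal_nbr e_irr Sn0 vS conU.
rewrite subUset sub1set -/(dominated e S).
suff -> : v \in dominated e S by [].
by apply/bigcupP; exists u; rewrite // !inE e_sym evu orbT.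
Qed.

Lemma game_open_closed (V : finType) (e : rel V) (p : player) (S : {set V}) :
  symmetric e -> irreflexive e -> induces_connected e S -> 1 < #|S| ->
  game_moves e (open_nbhd e) p S = game_moves e (closed_nbhd e) p S.
Proof.
move=> e_sym e_irr conS gt1.
apply: (eq_game_moves (P := fun S => induces_connected e S /\ 1 < #|S|)) => //.
  by move=> R [conR gtR]; apply: legal_open_closed.
move=> R v [conR gtR] lv; split; first by have /andP[] := position_legal lv.
exact: leq_trans gtR (subset_leq_card (subsetUr _ _)).
Qed.

(** * The opening moves and the two bounds *)

Lemma legal_set0 (V : finType) (e : rel V) (N : V -> {set V}) (v : V) :
  (v \in legal_moves e N set0) = (N v != set0).
Proof. by rewrite !inE setU0 induces_connected1 big_set0 subset0. Qed.

(** The vertex [v] does not totally dominate itself, so any neighbor has [v] as a new vertex to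
    totally dominate. *)
Lemma legal_open_set1 (V : finType) (e : rel V) (u v : V) :
  symmetric e -> irreflexive e ->
  (u \in legal_moves e (open_nbhd e) [set v]) = e v u.
Proof.
move=> e_sym e_irr; rewrite !inE big_set1.
apply/and3P/idP => [[uv conU _]|evu].
  have [||z /set1P-> ] := legal_nbr e_irr _ _ conU; rewrite ?inE //.
    by rewrite -card_gt0 cards1.
  by rewrite e_sym.
split.
- by apply: contraTneq evu => ->; rewrite e_irr.
- by apply: (induces_connectedU1 e_sym (induces_connected1 e v) (set11 v)); rewrite e_sym.
- by apply/subsetPn; exists v; rewrite !inE ?e_irr // e_sym.
Qed.

(** On a single vertex the total game has no move and the domination game has one, so the lower
    bound fails there. *)
Theorem theorem2p1 (V : finType) (e : rel V)
    (e_sym : symmetric e) (e_irr : irreflexive e)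
    (e_conn : connected_graph e) (V_gt1 : 1 < #|V|) :
  gamma_cg e <= gamma_tcg e /\ gamma_tcg e <= gamma_cg e + 2.
Proof.
have pos1 v : position e [set v].
  by rewrite /position -card_gt0 cards1 induces_connected1.
have nbr v : exists u, e v u.
  have conT : induces_connected e setT.
    apply/induces_connectedP => a b _ _.
    apply: connect_sub (e_conn a b) => c d ecd.
    by apply: connect1; rewrite /= ecd !inE.
  have /card_gt0P[x] : 0 < #|[set~ v]| by rewrite cardsC1 -ltnS prednK ?(ltnW V_gt1).
  rewrite !inE eq_sym => nvx.
  by have [u _ evu] := induces_connected_nbr conT (in_setT v) (in_setT x) nvx; exists u.
have first_open v : v \in legal_moves e (open_nbhd e) set0.
  by have [u evu] := nbr v; rewrite legal_set0; apply/set0Pn; exists u; rewrite inE.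
have first_closed v : v \in legal_moves e (closed_nbhd e) set0.
  by rewrite legal_set0; apply/set0Pn; exists v; rewrite !inE eqxx.
have [v0 _] : exists v0 : V, v0 \in [set: V].
  by apply/set0Pn; rewrite -card_gt0 cardsT ltnW.
have nonempty N : v0 \in legal_moves e N set0 -> legal_moves e N set0 != set0.
  by move=> l0; apply/set0Pn; exists v0.
have same p v u : e v u -> game_moves e (open_nbhd e) p (u |: [set v])
    = game_moves e (closed_nbhd e) p (u |: [set v]).
  move=> evu; apply: game_open_closed => //.
    by apply: (induces_connectedU1 e_sym (induces_connected1 e v) (set11 v)); rewrite e_sym.
  rewrite cardsU1 cards1 inE.
  by have -> : u != v by apply: contraTneq evu => ->; rewrite e_irr.
split; rewrite /gamma_cg /gamma_tcg.
(* Dominator opens with the optimal [v] of the total game; any reply [u] of Staller is also legal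
   there. *)
- have [[v _ ->] _] := game_movesP Dominator (nonempty _ (first_open v0)).
  apply: leq_trans (game_moves_Dominator (first_closed v)) _; rewrite ltnS setU0.
  have [->//|[u lu ->]] := game_moves_attained e (closed_nbhd e) Staller [set v].
  have evu : e v u.
    move: lu; rewrite inE => /and3P[uv conU _].
    have [|z /set1P->] := legal_nbr e_irr _ uv conU; last by rewrite e_sym.
    by case/andP: (pos1 v).
  rewrite -same //; apply: game_moves_Staller.
  by rewrite legal_open_set1.
(* Of the two extra moves, one is Staller's reply [u], perhaps illegal in the domination game, and
   one is the cost of the resulting pass. *)
- have [[v _ ->] _] := game_movesP Dominator (nonempty _ (first_closed v0)).
  apply: leq_trans (game_moves_Dominator (first_open v)) _.
  rewrite addn2 ltnS setU0.
  have [->//|[u lu ->]] := game_moves_attained e (open_nbhd e) Staller [set v].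
  have evu : e v u by rewrite legal_open_set1 in lu.
  rewrite ltnS same //; apply: leq_trans (game_closed_pass e_sym e_irr e_conn (pos1 v)).
  apply: (game_closed_mono _ e_sym e_irr e_conn (pos1 v) (w := u)).
  + exact: position_legal lu.
  + by rewrite /dominated big_set1 !inE evu orbT.
  + exact: dominatedU1.
Qed.
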